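(* Let $(R_1,\mathcal L_1)$ and $(R_2,\mathcal L_2)$ be sets with a language. Let $\sim$ be an equivalence relation on $R_2$ and let $\pi:R_2\to R_2/{\sim}$ be the projection. Let $d:R_1\to R_2/{\sim}$ be an injective map such that: (1) for all constants $c\in\mathcal L_1$, $\overline d(c)\subset R_2$ is a Diophantine set; (2) for all $k$-ary functions $f\in\mathcal L_1$, $\overline d(\{(\vec x,f(\vec x))\mid\vec x\in R_1^k\})$ is a Diophantine set; (3) for all relations $S\in\mathcal L_1$, $\overline d(S)$ is a Diophantine set; (4) the set $\overline d(R_1)$ is Diophantine; (5) the set $\{(x,y)\in R_2^2\mid x\sim y\}$ or the set $\{(x,y)\in R_2^2\mid x,y\in\overline d(R_1),\ x\sim y\}$ is Diophantine. Then $d$ is a Diophantine equivalence map.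
   Context: A ''set with a language'' $(R,\mathcal L)$ is a set $R$ together with a language $\mathcal L$ (constants, functions, relations) with an interpretation in $R$; every language contains a constant $0$ and equality. Terms of $\mathcal L$ are built from constants of $\mathcal L$ and variables using functions of $\mathcal L$; a basic formula has the form $(t_1,\ldots,t_k)\in R'$ with $R'\in\mathcal L$ a $k$-ary relation (possibly equality) and $t_i$ terms. $S\subset R^k$ is Diophantine if $S=\{\vec x\in R^k\mid\exists\vec y\in R^l\ (f_1\wedge\cdots\wedge f_r)\}$ for some basic formulas $f_i$. For $d:R_1\to R_2/{\sim}$ and $S\subset R_1^k$, let $d(S)$ be the coordinatewise image and $\overline d(S)=\{\vec x\in R_2^k\mid(\pi(x_1),\ldots,\pi(x_k))\in d(S)\}$; write $\overline d(c)$ for $\overline d(\{c\})$. The map $d$ is a Diophantine equivalence map if for all $k$ and all Diophantine $S\subset R_1^k$ the set $\overline d(S)\subset R_2^k$ is Diophantine. *)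

(* Defs.v *)
From mathcomp Require Import all_boot.
From mathcomp Require Import boolp classical_sets.
From Stdlib Require Import RelationClasses.
Set Implicit Arguments.
Unset Strict Implicit.
Unset Printing Implicit Defensive.
Local Open Scope classical_set_scope.

(* Equality, which every language contains, is not a member of [rel_sym]: it is
   built into the basic formulas below and always interpreted as equality. *)
Record language := Language {
  const_sym : Type;
  fun_sym : nat -> Type; (* [fun_sym k]: the k-ary function symbols *)
  rel_sym : nat -> Type; (* [rel_sym k]: the k-ary relation symbols *)
  zero : const_sym
}.

Record structure (L : language) := Structure {
  carrier :> Type;
  icst : const_sym L -> carrier;
  ifct : forall k, fun_sym L k -> k.-tuple carrier -> carrier;
  irel : forall k, rel_sym L k -> set (k.-tuple carrier)
}.

Inductive term (L : language) (n : nat) : Type :=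
| Var of 'I_n
| Cst of const_sym L
| App k of fun_sym L k & ('I_k -> term L n).

Inductive basic_formula (L : language) (n : nat) : Type :=
| EqFormula of term L n & term L n
| RelFormula k of rel_sym L k & ('I_k -> term L n).

Fixpoint eval (L : language) (R : structure L) n (v : n.-tuple R)
    (t : term L n) : R :=
  match t with
  | Var i => tnth v i
  | Cst c => icst R c
  | App k f ts => ifct f [tuple eval v (ts i) | i < k]
  end.

Definition holds (L : language) (R : structure L) n (v : n.-tuple R)
    (f : basic_formula L n) : Prop :=
  match f with
  | EqFormula t u => eval v t = eval v u
  | RelFormula k r ts => irel r [tuple eval v (ts i) | i < k]
  end.

(* The first k variables are the free ones, the last l the quantified ones. *)
Definition diophantine (L : language) (R : structure L) k
    (S : set (k.-tuple R)) : Prop :=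
  exists (l r : nat) (f : 'I_r -> basic_formula L (k + l)),
    S = [set x : k.-tuple R | exists y : l.-tuple R,
                   forall i, holds [tuple of x ++ y] (f i)].

(* Equivalence classes; meant for an equivalence relation [sim]. *)
Definition quotient (T : Type) (sim : T -> T -> Prop) : Type :=
  {A : set T | exists x, A = [set y | sim x y]}.

Definition proj (T : Type) (sim : T -> T -> Prop) (x : T) : quotient sim :=
  exist _ [set y | sim x y] (ex_intro _ x erefl).

Definition dbar (T1 T2 : Type) (sim : T2 -> T2 -> Prop) (d : T1 -> quotient sim)
    k (S : set (k.-tuple T1)) : set (k.-tuple T2) :=
  map_tuple (@proj T2 sim) @^-1` (map_tuple d @` S).

Definition diophantine_equivalence_map (L1 L2 : language) (R1 : structure L1)
    (R2 : structure L2) (sim : R2 -> R2 -> Prop) (d : R1 -> quotient sim) : Prop :=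
  forall k (S : set (k.-tuple R1)), diophantine S -> diophantine (dbar d S).

(* Main.v *)
Require Import Defs.
From mathcomp Require Import all_boot.
From mathcomp Require Import boolp classical_sets.
From Stdlib Require Import RelationClasses.
Set Implicit Arguments.
Unset Strict Implicit.
Unset Printing Implicit Defensive.
Local Open Scope classical_set_scope.

(** A subset of R1^k is coded by the tuples of R2 that represent, class by
    class, the image under [d] of one of its members.  Call a relation on R1
    codable if its set of codes is Diophantine over [R2].  The hypotheses say
    that constants, function graphs, the relations of the language, the full set
    and equality are codable; for equality, both variants of the hypothesis on
    [sim] lead to the same set once the variables are restricted to codes of
    elements of [R1].

    Diophantine sets are closed under finite intersections, substitution of
    variables and projections.  Codable relations inherit these closures
    ([codable_and], [codable_reindex], [codable_exists]): intersections because
    [d] is injective, so that a code determines what it codes, and projections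
    because the projection to the quotient is surjective, so that every element
    of [R1] has a code.  A term is unnested into the graphs of its function
    symbols, by introducing an existentially quantified variable for each
    subterm, so its graph is codable by induction ([codable_term]); so is every
    basic formula ([codable_holds]), and hence every Diophantine subset
    of R1^k.

    Assignments of values to variables are handled as functions on ordinals
    rather than as tuples, so that substituting variables is composition. *)

(** * Assignments and renaming of variables *)

(** The concatenation of two assignments. *)
Definition vcat (T : Type) n m (v : 'I_n -> T) (w : 'I_m -> T) :
    'I_(n + m) -> T :=
  fun i => match split i with inl j => v j | inr j => w j end.

Lemma vcat_lshift T n m (v : 'I_n -> T) (w : 'I_m -> T) i :
  vcat v w (lshift m i) = v i.
Proof. by rewrite /vcat (unsplitK (inl i)). Qed.

Lemma vcat_rshift T n m (v : 'I_n -> T) (w : 'I_m -> T) i :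
  vcat v w (rshift n i) = w i.
Proof. by rewrite /vcat (unsplitK (inr i)). Qed.

Lemma vcat_comp_lshift T n m (v : 'I_n -> T) (w : 'I_m -> T) :
  vcat v w \o @lshift n m = v.
Proof. by apply/funext => i; exact: vcat_lshift. Qed.

Lemma vcat_comp_rshift T n m (v : 'I_n -> T) (w : 'I_m -> T) :
  vcat v w \o @rshift n m = w.
Proof. by apply/funext => i; exact: vcat_rshift. Qed.

Lemma vcat_split T n m (u : 'I_(n + m) -> T) :
  u = vcat (u \o @lshift n m) (u \o @rshift n m).
Proof.
by apply/funext => i; case: (split_ordP i) => j ->;
  rewrite ?vcat_lshift ?vcat_rshift.
Qed.

Lemma tnth_vcat T n m (x : n.-tuple T) (y : m.-tuple T) :
  tnth [tuple of x ++ y] = vcat (tnth x) (tnth y).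
Proof.
apply/funext => i; case: (split_ordP i) => j ->.
  by rewrite tnth_lshift vcat_lshift.
by rewrite tnth_rshift vcat_rshift.
Qed.

Lemma mktuple_tnth T n (x : n.-tuple T) : mktuple (tnth x) = x.
Proof. by apply: eq_from_tnth => i; rewrite tnth_mktuple. Qed.

Lemma tnth_mktupleE T n (v : 'I_n -> T) : tnth (mktuple v) = v.
Proof. by apply/funext => i; rewrite tnth_mktuple. Qed.

Fixpoint rename_term L n m (s : 'I_n -> 'I_m) (t : term L n) : term L m :=
  match t with
  | Var i => Var L (s i)
  | Cst c => Cst m c
  | App k f ts => App f (fun i => rename_term s (ts i))
  end.

Definition rename_formula L n m (s : 'I_n -> 'I_m) (f : basic_formula L n) :
    basic_formula L m :=
  match f with
  | EqFormula t u => EqFormula (rename_term s t) (rename_term s u)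
  | RelFormula k r ts => RelFormula r (fun i => rename_term s (ts i))
  end.

Lemma eval_rename L (R : structure L) n m (s : 'I_n -> 'I_m)
    (v : 'I_m -> R) (t : term L n) :
  eval (mktuple v) (rename_term s t) = eval (mktuple (v \o s)) t.
Proof.
elim: t => [i|c|k f ts IH] //=; first by rewrite !tnth_mktuple.
by congr (ifct _ (mktuple _)); apply/funext => i; exact: IH.
Qed.

Lemma holds_rename L (R : structure L) n m (s : 'I_n -> 'I_m)
    (v : 'I_m -> R) (f : basic_formula L n) :
  holds (mktuple v) (rename_formula s f) = holds (mktuple (v \o s)) f.
Proof.
case: f => [t u|k r ts] /=; first by rewrite !eval_rename.
by congr (@irel _ _ _ _ (mktuple _)); apply/funext => i; exact: eval_rename.
Qed.

(** * Closure properties of Diophantine sets *)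

(** A set of assignments is definable if the corresponding set of tuples is
    Diophantine. *)
Definition definable L (R : structure L) n (P : set ('I_n -> R)) : Prop :=
  diophantine [set x : n.-tuple R | P (tnth x)].

Lemma definableP L (R : structure L) n (P : set ('I_n -> R)) :
  definable P <->
  exists (l r : nat) (f : 'I_r -> basic_formula L (n + l)),
    forall v, P v <-> exists w : 'I_l -> R,
      forall i, holds (mktuple (vcat v w)) (f i).
Proof.
split=> -[l [r [f E]]]; exists l, r, f.
  move=> v; have -> : P v = [set x : n.-tuple R | P (tnth x)] (mktuple v).
    by rewrite /= tnth_mktupleE.
  rewrite E /=; split=> [[y H]|[w H]].
    exists (tnth y) => i; move: (H i).
    by rewrite -[X in holds X]mktuple_tnth tnth_vcat tnth_mktupleE.
  exists (mktuple w) => i.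
  by rewrite -[X in holds X]mktuple_tnth tnth_vcat !tnth_mktupleE.
apply/seteqP; split=> x /=.
  move/E => [w H]; exists (mktuple w) => i.
  by rewrite -[X in holds X]mktuple_tnth tnth_vcat tnth_mktupleE.
move=> [y H]; apply/E; exists (tnth y) => i; move: (H i).
by rewrite -[X in holds X]mktuple_tnth tnth_vcat.
Qed.

Lemma definable_setT L (R : structure L) n : definable [set: 'I_n -> R].
Proof.
apply/definableP; exists 0, 0, (fun=> EqFormula (Cst _ (Defs.zero L)) (Cst _ (Defs.zero L))).
by move=> v; split=> // _; exists (fun=> icst R (Defs.zero L)).
Qed.

Lemma definable_reindex L (R : structure L) n m (s : 'I_n -> 'I_m)
    (P : set ('I_n -> R)) :
  definable P -> definable [set v : 'I_m -> R | P (v \o s)].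
Proof.
move=> /definableP[l [r [f E]]]; apply/definableP.
(* The free variables are renamed by [s], the quantified ones are kept. *)
pose s' : 'I_(n + l) -> 'I_(m + l) := vcat (@lshift m l \o s) (@rshift m l).
have s'E (v : 'I_m -> R) (w : 'I_l -> R) : vcat v w \o s' = vcat (v \o s) w.
  rewrite [LHS]vcat_split; congr vcat; apply/funext => i /=.
    by rewrite /s' vcat_lshift /= vcat_lshift.
  by rewrite /s' vcat_rshift vcat_rshift.
exists l, r, (fun i => rename_formula s' (f i)) => v /=.
by split=> [/E|] [w H]; [|apply/E]; exists w => i; move: (H i);
  rewrite holds_rename s'E.
Qed.

Lemma definable_and L (R : structure L) n (P Q : set ('I_n -> R)) :
  definable P -> definable Q -> definable (P `&` Q).
Proof.
move=> /definableP[l1 [r1 [f1 E1]]] /definableP[l2 [r2 [f2 E2]]].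
apply/definableP.
(* Each of the two sets keeps its own quantified variables. *)
pose s1 : 'I_(n + l1) -> 'I_(n + (l1 + l2)) :=
  vcat (@lshift n (l1 + l2)) (@rshift n (l1 + l2) \o @lshift l1 l2).
pose s2 : 'I_(n + l2) -> 'I_(n + (l1 + l2)) :=
  vcat (@lshift n (l1 + l2)) (@rshift n (l1 + l2) \o @rshift l1 l2).
have s1E (v : 'I_n -> R) (w : 'I_(l1 + l2) -> R) :
    vcat v w \o s1 = vcat v (w \o @lshift l1 l2).
  rewrite [LHS]vcat_split; congr vcat; apply/funext => i /=.
    by rewrite /s1 vcat_lshift vcat_lshift.
  by rewrite /s1 vcat_rshift /= vcat_rshift.
have s2E (v : 'I_n -> R) (w : 'I_(l1 + l2) -> R) :
    vcat v w \o s2 = vcat v (w \o @rshift l1 l2).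
  rewrite [LHS]vcat_split; congr vcat; apply/funext => i /=.
    by rewrite /s2 vcat_lshift vcat_lshift.
  by rewrite /s2 vcat_rshift /= vcat_rshift.
exists (l1 + l2), (r1 + r2),
  (vcat (fun i => rename_formula s1 (f1 i)) (fun i => rename_formula s2 (f2 i))).
move=> v; split=> [[/E1[w1 H1] /E2[w2 H2]]|[w H]].
  exists (vcat w1 w2) => i; case: (split_ordP i) => j ->.
    by rewrite vcat_lshift holds_rename s1E vcat_comp_lshift.
  by rewrite vcat_rshift holds_rename s2E vcat_comp_rshift.
split; [apply/E1|apply/E2].
  exists (w \o @lshift l1 l2) => i; move: (H (lshift r2 i)).
  by rewrite vcat_lshift holds_rename s1E.
exists (w \o @rshift l1 l2) => i; move: (H (rshift r1 i)).
by rewrite vcat_rshift holds_rename s2E.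
Qed.

Lemma definable_exists L (R : structure L) n m (P : set ('I_(n + m) -> R)) :
  definable P -> definable [set v : 'I_n -> R | exists w, P (vcat v w)].
Proof.
move=> /definableP[l [r [f E]]]; apply/definableP.
(* The projected variables join the quantified ones, as [n + m + l] variables
   are regrouped into [n + (m + l)]. *)
pose s : 'I_(n + m + l) -> 'I_(n + (m + l)) :=
  vcat (vcat (@lshift n (m + l)) (@rshift n (m + l) \o @lshift m l))
       (@rshift n (m + l) \o @rshift m l).
have sE (v : 'I_n -> R) (w : 'I_(m + l) -> R) :
    vcat v w \o s =
    vcat (vcat v (w \o @lshift m l)) (w \o @rshift m l).
  rewrite [LHS]vcat_split; congr vcat; last first.
    by apply/funext => i /=; rewrite /s vcat_rshift /= vcat_rshift.
  rewrite [LHS]vcat_split; congr vcat; apply/funext => i /=.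
    by rewrite /s !vcat_lshift.
  by rewrite /s vcat_lshift vcat_rshift /= vcat_rshift.
exists (m + l), r, (fun i => rename_formula s (f i)) => v /=.
split=> [[w /E[w' H]]|[w H]].
  exists (vcat w w') => i.
  by rewrite holds_rename sE vcat_comp_lshift vcat_comp_rshift.
exists (w \o @lshift m l); apply/E; exists (w \o @rshift m l) => i.
by move: (H i); rewrite holds_rename sE.
Qed.

(** * Codable relations *)

(** [x] codes [a] if [x] lies in the class that [d] assigns to [a]. *)
Definition codes (T1 T2 : Type) (sim : T2 -> T2 -> Prop)
    (d : T1 -> quotient sim) (x : T2) (a : T1) : Prop :=
  proj sim x = d a.

Lemma codes_surj T1 T2 (sim : T2 -> T2 -> Prop) (d : T1 -> quotient sim)
    (a : T1) : exists x, codes d x a.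
Proof.
rewrite /codes; case: (d a) => A [x Ax]; exists x.
by subst A; congr exist; exact: Prop_irrelevance.
Qed.

(** The assignments that code, variable by variable, some member of [P]. *)
Definition code_set (T1 T2 : Type) (sim : T2 -> T2 -> Prop)
    (d : T1 -> quotient sim) n (P : set ('I_n -> T1)) : set ('I_n -> T2) :=
  [set z | exists2 u, P u & forall i, codes d (z i) (u i)].

Lemma dbarE T1 T2 (sim : T2 -> T2 -> Prop) (d : T1 -> quotient sim) n
    (S : set (n.-tuple T1)) :
  dbar d S = [set z | code_set d [set u | S (mktuple u)] (tnth z)].
Proof.
apply/seteqP; split=> z /=.
  move=> [x Sx E]; exists (tnth x); first by rewrite /= mktuple_tnth.
  by move=> i; move: (congr1 (fun t => tnth t i) E); rewrite /codes !tnth_map => <-.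
move=> [u Su E]; exists (mktuple u) => //.
by apply: eq_from_tnth => i; rewrite !tnth_map tnth_ord_tuple -E.
Qed.

(** A relation on the domain of [d] is codable if its set of codes is
    definable. *)
Definition codable (T1 : Type) L (R : structure L) (sim : R -> R -> Prop)
    (d : T1 -> quotient sim) n (P : set ('I_n -> T1)) : Prop :=
  definable (code_set d P).

Lemma codable_dbar T1 L (R : structure L) (sim : R -> R -> Prop)
    (d : T1 -> quotient sim) n (S : set (n.-tuple T1)) :
  diophantine (dbar d S) <-> codable d [set u | S (mktuple u)].
Proof. by rewrite dbarE. Qed.

Section Closure.
Variables (T1 : Type) (L : language) (R : structure L) (sim : R -> R -> Prop).
Variables (d : T1 -> quotient sim).
Hypothesis d_inj : injective d.
Hypothesis codable_setT1 : codable d [set: 'I_1 -> T1].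

Lemma codes_inj (x : R) (a b : T1) : codes d x a -> codes d x b -> a = b.
Proof. by rewrite /codes => -> /d_inj. Qed.

Lemma codable_and n (P Q : set ('I_n -> T1)) :
  codable d P -> codable d Q -> codable d (P `&` Q).
Proof.
move=> cP cQ; rewrite /codable.
suff -> : code_set d (P `&` Q) = code_set d P `&` code_set d Q.
  exact: definable_and.
apply/seteqP; split=> z; first by move=> [u [Pu Qu] H]; split; exists u.
move=> [[u Pu H] [u' Qu' H']].
have E : u' = u by apply/funext => i; exact: codes_inj (H' i) (H i).
by subst u'; exists u.
Qed.

(** Codes of elements of the domain of [d] can be required at finitely many
    places. *)
Lemma definable_forall_codes n m (s : 'I_m -> 'I_n) :
  definable [set z : 'I_n -> R | forall i, exists a, codes d (z (s i)) a].
Proof.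
elim: m s => [|m IH] s.
  suff -> : [set z : 'I_n -> R | forall i, exists a, codes d (z (s i)) a]
    = setT by exact: definable_setT.
  by apply/seteqP; split=> // z _ [].
have := definable_and (definable_reindex (fun=> s ord0) codable_setT1)
  (IH (s \o lift ord0)).
congr definable; apply/seteqP; split=> z /=.
  move=> [[u _ H0] H] i; case: (unliftP ord0 i) => [j ->|->]; first exact: H.
  by exists (u ord0); exact: H0.
move=> H; split; last by move=> i; exact: H.
by have [a Ha] := H ord0; exists (fun=> a).
Qed.

Lemma codable_setT n : codable d [set: 'I_n -> T1].
Proof.
have := @definable_forall_codes n n id; congr definable.
apply/seteqP; split=> z /=; last by move=> [u _ H] i; exists (u i).
by move=> /choice[u H]; exists u.
Qed.

Lemma codable_reindex n m (s : 'I_n -> 'I_m) (P : set ('I_n -> T1)) :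
  codable d P -> codable d [set u : 'I_m -> T1 | P (u \o s)].
Proof.
(* The variables outside the image of [s] must still be codes. *)
move=> cP; have := definable_and (definable_reindex s cP) (codable_setT m).
congr definable; apply/seteqP; split=> z /=.
  move=> [[u Pu H] [u' _ H']]; exists u' => //=.
  suff -> : u' \o s = u by [].
  by apply/funext => i; exact: codes_inj (H' (s i)) (H i).
by move=> [u Pu H]; split; [exists (u \o s) => // i; exact: H|exists u].
Qed.

Lemma codable_forall n m (P : 'I_m -> set ('I_n -> T1)) :
  (forall i, codable d (P i)) -> codable d [set u | forall i, P i u].
Proof.
elim: m P => [|m IH] P cP.
  suff -> : [set u | forall i, P i u] = setT by exact: codable_setT.
  by apply/seteqP; split=> // u _ [].
have := codable_and (cP ord0) (IH _ (fun i => cP (lift ord0 i))).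
congr codable; apply/seteqP; split=> u /=; last by move=> H; split.
by move=> [H0 H] i; case: (unliftP ord0 i) => [j ->|->].
Qed.

Lemma codable_exists n m (P : set ('I_(n + m) -> T1)) :
  codable d P -> codable d [set v : 'I_n -> T1 | exists w, P (vcat v w)].
Proof.
move=> cP; have := definable_exists cP; congr definable.
apply/seteqP; split=> z /=.
  move=> [w [u Pu H]]; exists (u \o @lshift n m).
    by exists (u \o @rshift n m); rewrite -vcat_split.
  by move=> i; move: (H (lshift m i)); rewrite vcat_lshift.
move=> [v [w Pvw] H].
have [x Hx] := choice (fun i => codes_surj d (w i)).
exists x, (vcat v w) => // i.
by case: (split_ordP i) => j ->; rewrite ?vcat_lshift ?vcat_rshift.
Qed.

End Closure.

(** * Codability of terms and formulas *)

Section Formulas.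
Variables (L1 L2 : language) (R1 : structure L1) (R2 : structure L2).
Variables (sim : R2 -> R2 -> Prop) (d : R1 -> quotient sim).
Hypothesis d_inj : injective d.
Hypothesis codable_setT1 : codable d [set: 'I_1 -> R1].
Hypothesis codable_eq : codable d [set u : 'I_2 -> R1 | u ord0 = u ord_max].
Hypothesis codable_cst : forall c : const_sym L1,
  codable d [set u : 'I_1 -> R1 | u ord0 = icst R1 c].
Hypothesis codable_fct : forall k (f : fun_sym L1 k),
  codable d [set u : 'I_k.+1 -> R1 |
    u ord_max = ifct f (mktuple (u \o lift ord_max))].
Hypothesis codable_rel : forall k (r : rel_sym L1 k),
  codable d [set u : 'I_k -> R1 | irel r (mktuple u)].

(** The graph of a term is codable.  The variables of the term and its value
    occupy arbitrary places of a longer assignment, so that the induction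
    hypothesis applies directly after new variables have been introduced. *)
Lemma codable_term n (t : term L1 n) m (s : 'I_n -> 'I_m) (j : 'I_m) :
  codable d [set u : 'I_m -> R1 | u j = eval (mktuple (u \o s)) t].
Proof.
elim: t m s j => [i|c|k f ts IH] m s j /=.
- have := codable_reindex d_inj codable_setT1
    (fun b : 'I_2 => if b == ord0 then j else s i) codable_eq.
  by congr codable; apply/funext => u /=; rewrite tnth_mktuple.
- exact: (codable_reindex d_inj codable_setT1 (fun=> j) (codable_cst c)).
(* The values of the arguments are the [k] last of [m + k] variables. *)
have cargs : codable d [set u : 'I_(m + k) -> R1 | forall i,
    u (rshift m i) = eval (mktuple (u \o (@lshift m k \o s))) (ts i)].
  by apply: codable_forall => // i; exact: IH.
have cf := codable_reindex d_inj codable_setT1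
  (fun i => oapp (@rshift m k) (lshift k j) (unlift ord_max i))
  (codable_fct f).
have := codable_exists (codable_and d_inj cargs cf).
congr codable; apply/seteqP; split=> u /=.
  move=> [w [Hw]]; rewrite unlift_none /= vcat_lshift => ->.
  congr (ifct _ (mktuple _)); apply/funext => i /=.
  by rewrite liftK /= Hw compA vcat_comp_lshift.
move=> Hu; exists (fun i => eval (mktuple (u \o s)) (ts i)); split.
  by move=> i; rewrite vcat_rshift compA vcat_comp_lshift.
rewrite unlift_none /= vcat_lshift Hu; congr (ifct _ (mktuple _)).
by apply/funext => i /=; rewrite liftK /= vcat_rshift.
Qed.

Lemma codable_holds n (f : basic_formula L1 n) :
  codable d [set u : 'I_n -> R1 | holds (mktuple u) f].
Proof.
case: f => [t t'|k r ts] /=.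
  have := codable_exists (codable_and d_inj
    (codable_term t (@lshift n 1) (rshift n ord0))
    (codable_term t' (@lshift n 1) (rshift n ord0))).
  congr codable; apply/seteqP; split=> u /=.
    by move=> [w]; rewrite vcat_comp_lshift => -[-> ].
  move=> E; exists (fun=> eval (mktuple u) t).
  by rewrite vcat_rshift vcat_comp_lshift.
have cargs : codable d [set u : 'I_(n + k) -> R1 | forall i,
    u (rshift n i) = eval (mktuple (u \o @lshift n k)) (ts i)].
  by apply: codable_forall => // i; exact: codable_term.
have := codable_exists (codable_and d_inj cargs
  (codable_reindex d_inj codable_setT1 (@rshift n k) (codable_rel r))).
congr codable; apply/seteqP; split=> u /=.
  move=> [w]; rewrite vcat_comp_lshift vcat_comp_rshift => -[Hw].
  suff -> : w = (fun i => eval (mktuple u) (ts i)) by [].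
  by apply/funext => i; rewrite -Hw vcat_rshift.
move=> Hu; exists (fun i => eval (mktuple u) (ts i)).
rewrite vcat_comp_lshift vcat_comp_rshift; split=> // i.
by rewrite vcat_rshift.
Qed.

Lemma codable_definable n (P : set ('I_n -> R1)) : definable P -> codable d P.
Proof.
move=> /definableP[l [r [f E]]].
have := codable_exists
  (codable_forall d_inj codable_setT1 (fun i => codable_holds (f i))).
by congr codable; apply/seteqP; split=> u /E.
Qed.

End Formulas.

(** Once the full set is codable, either variant of the hypothesis on [sim]
    makes equality codable: two codes represent the same element exactly when
    they are equivalent. *)
Lemma codable_eq_of_sim T1 L (R : structure L) (sim : R -> R -> Prop)
    (d : T1 -> quotient sim) : Equivalence sim -> injective d ->
  codable d [set: 'I_1 -> T1] ->
  (diophantine [set z : 2.-tuple R | exists x y : R,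
      z = [tuple x; y] /\ sim x y] \/
   diophantine [set z : 2.-tuple R | exists x y : R,
      [/\ z = [tuple x; y], dbar d [set: 1.-tuple T1] [tuple x],
          dbar d [set: 1.-tuple T1] [tuple y] & sim x y]]) ->
  codable d [set u : 'I_2 -> T1 | u ord0 = u ord_max].
Proof.
move=> sim_equiv d_inj cT1 d_sim.
have projE x y : proj sim x = proj sim y <-> sim x y.
  split=> [[E]|xy].
    have : [set z | sim y z] y by exact: reflexivity.
    by rewrite -E.
  apply: eq_exist; apply/seteqP; split=> z /= H.
    by apply: transitivity H; exact: symmetry.
  exact: transitivity xy H.
have ord2 (i : 'I_2) : i = ord0 \/ i = ord_max.
  by case: i => [[|[|//]] lti]; [left|right]; exact: val_inj.
have tuple2 (z : 2.-tuple R) : z = [tuple tnth z ord0; tnth z ord_max].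
  by apply: eq_from_tnth => i; case: (ord2 i) => ->.
have domE x : dbar d [set: 1.-tuple T1] [tuple x] <-> exists a, codes d x a.
  rewrite dbarE; split=> [[u _ /(_ ord0) H]|[a Ha]]; first by exists (u ord0).
  by exists (fun=> a) => // i; rewrite (ord1 i).
have codeE (z : 'I_2 -> R) :
    code_set d [set u : 'I_2 -> T1 | u ord0 = u ord_max] z <->
    sim (z ord0) (z ord_max) /\ code_set d [set: 'I_2 -> T1] z.
  split=> [[u E H]|[/projE E [u _ H]]].
    by split; [apply/projE; rewrite (H ord0) (H ord_max) E|exists u].
  by exists u => //=; apply: d_inj; rewrite -H -H.
rewrite /codable /definable; case: d_sim => dio.
  have := definable_and (P := [set z | sim (z ord0) (z ord_max)]) _
    (codable_setT cT1 2).
  have -> : code_set d [set u : 'I_2 -> T1 | u ord0 = u ord_max] =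
      [set z | sim (z ord0) (z ord_max)] `&` code_set d setT.
    by apply/seteqP; split=> z /codeE.
  apply; move: dio; congr diophantine; apply/seteqP; split=> z /=.
    by move=> [x [y [-> H]]].
  by exists (tnth z ord0), (tnth z ord_max).
move: dio; congr diophantine; apply/seteqP; split=> z /=.
  move=> [x [y [-> /domE[a Ha] /domE[b Hb] xy]]]; apply/codeE; split=> //.
  exists (fun i => tnth [tuple a; b] i) => // i.
  by case: (ord2 i) => ->.
move=> /codeE[E [u _ H]]; exists (tnth z ord0), (tnth z ord_max).
by split=> //; apply/domE; [exists (u ord0)|exists (u ord_max)].
Qed.

Theorem theorem1p7 (L1 L2 : language) (R1 : structure L1) (R2 : structure L2)
    (sim : R2 -> R2 -> Prop) (sim_equiv : Equivalence sim)
    (d : R1 -> quotient sim) (d_inj : injective d)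
    (d_cst : forall c : const_sym L1, diophantine (dbar d [set [tuple icst R1 c]]))
    (d_fct : forall k (f : fun_sym L1 k),
       diophantine (dbar d [set [tuple of rcons x (ifct f x)]
                               | x in [set: k.-tuple R1]]))
    (d_rel : forall k (r : rel_sym L1 k), diophantine (dbar d (@irel L1 R1 k r)))
    (d_dom : diophantine (dbar d [set: 1.-tuple R1]))
    (d_sim : diophantine [set z : 2.-tuple R2 | exists x y : R2,
                            z = [tuple x; y] /\ sim x y] \/
             diophantine [set z : 2.-tuple R2 | exists x y : R2,
                            [/\ z = [tuple x; y],
                                dbar d [set: 1.-tuple R1] [tuple x],
                                dbar d [set: 1.-tuple R1] [tuple y] &
                                sim x y]]) :
  diophantine_equivalence_map d.
Proof.
have cT1 : codable d [set: 'I_1 -> R1] := (codable_dbar d setT).1 d_dom.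
have ceq := codable_eq_of_sim sim_equiv d_inj cT1 d_sim.
move=> k S dS; apply/codable_dbar; apply: (codable_definable d_inj cT1 ceq).
- move=> c; have /codable_dbar := d_cst c; congr codable.
  apply/seteqP; split=> u /= E.
    by rewrite -[LHS](tnth_mktuple u) E.
  by apply: eq_from_tnth => i; rewrite (ord1 i) tnth_mktuple.
(* The value of the function is the last entry of a tuple in its graph, and
   [lift ord_max] enumerates the other places. *)
- move=> n f; have /codable_dbar := d_fct n f; congr codable.
  apply/seteqP; split=> u /=.
    move=> [x _ E].
    have {}E i : u i = nth (u ord_max) (rcons x (ifct f x)) i.
      by rewrite -[LHS](tnth_mktuple u) -E (tnth_nth (u ord_max)).
    rewrite [LHS]E nth_rcons size_tuple ltnn eqxx; congr ifct.
    apply: eq_from_tnth => i.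
    rewrite tnth_mktuple /= E lift_max nth_rcons size_tuple ltn_ord.
    exact: tnth_nth.
  move=> E; exists (mktuple (u \o lift ord_max)) => //; rewrite -E.
  apply: eq_from_tnth => i; rewrite tnth_mktuple (tnth_nth (u ord_max)) /=.
  rewrite nth_rcons size_map size_enum_ord.
  case: (unliftP ord_max i) => [j ->|->]; last by rewrite ltnn eqxx.
  rewrite lift_max ltn_ord -[RHS](tnth_mktuple (u \o lift ord_max)).
  by rewrite (tnth_nth (u ord_max)).
- by move=> n r; exact/codable_dbar.
by move: dS; congr diophantine; apply/seteqP; split=> x /=;
  rewrite mktuple_tnth.
Qed.
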